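(* (Coherent Newman's lemma) Let $X$ be a terminating left-monomial $1$-polygraph, and $Y$ be a cellular extension of the free $1$-algebra $\mathcal{A}(X)$. If $X$ is locally $Y$-confluent then it is $Y$-confluent.
   Context: Fix a field $\mathbb{K}$; algebras are unital associative $\mathbb{K}$-algebras. A $1$-polygraph $X=\langle X_0\,|\,X_1\rangle$ is a set $X_0$ and a set $X_1$ (of ''$1$-cells'') with two maps $s,t:X_1\to\mathcal{A}(X_0)$ into the free algebra on $X_0$. Monomials are the elements of the free monoid $X_0^*$; $\mathrm{supp}(a)$ is the set of monomials with nonzero coefficient in $a\in\mathcal{A}(X_0)$. $X$ is left-monomial if, for each $\alpha\in X_1$, $s(\alpha)$ is a monomial not belonging to $\mathrm{supp}(t(\alpha))$. The free $1$-algebra $\mathcal{A}(X)$ has as $0$-cells the elements of $\mathcal{A}(X_0)$; its $1$-cells are the elements of the quotient of the $\mathcal{A}(X_0)$-bimodule $(\mathcal{A}(X_0)\otimes\mathbb{K}X_1\otimes\mathcal{A}(X_0))\oplus\mathcal{A}(X_0)$ by the sub-bimodule generated by the elements $(a s(b)+t(a)b-t(a)s(b))-(s(a)b+a t(b)-s(a)t(b))$ for $a,b$ in the first summand, where $s(a\alpha b)=a s(\alpha) b$, $t(a\alpha b)=a t(\alpha) b$, and an element $c$ of the second summand is the identity $1_c$, with source and target $c$. Composition of $f:a\to b$ and $g:b\to c$ is $f\star_0 g=f-1_b+g$. A $1$-monomial is a $1$-cell $u\alpha v$ with $u,v$ monomials and $\alpha\in X_1$. Let $X$ be left-monomial. A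 rewriting step is a $1$-cell $\lambda f+1_a$ with $f$ a $1$-monomial, $\lambda\in\mathbb{K}\setminus\{0\}$ and $a$ a $0$-cell with $s(f)\notin\mathrm{supp}(a)$. A positive $1$-cell is a (possibly empty) composite of rewriting steps. Let $\succ_X$ be the smallest transitive relation on $X_0^*$ that is stable by product and such that $s(\alpha)\succ_X v$ for all $\alpha\in X_1$, $v\in\mathrm{supp}(t(\alpha))$; $X$ terminates if $\succ_X$ is wellfounded. A branching of $X$ is a pair of positive $1$-cells with the same source; it is local if both are rewriting steps. A cellular extension $Y$ of $\mathcal{A}(X)$ is a set $Y$ with two maps $s,t$ from $Y$ to the $1$-cells of $\mathcal{A}(X)$ such that $s(y)$ and $t(y)$ have the same source and the same target. The free $2$-algebra $\mathcal{A}(X)[Y]$ extends $\mathcal{A}(X)$ with $2$-cells, namely the elements of the quotient of the $\mathcal{A}(X_0)$-bimodule $(\mathcal{A}(X_0)\otimes\mathbb{K}Y\otimes\mathcal{A}(X_0))\oplus\{1\text{-cells of }\mathcal{A}(X)\}$ by the sub-bimodule generated by the elements $(a s_0(b)+t_0(a)b-t_0(a)s_0(b))-(s_0(a)b+a t_0(b)-s_0(a)t_0(b))$ for $a,b$ in the first summand, with $s(ayb)=a s(y) b$, $t(ayb)=a t(y) b$, $s_0,t_0$ the $0$-dimensional source and target, and $s(f)=t(f)=f$ for $f$ in the second summand. A branching $(f,g)$ is $Y$-confluent if there exist positive $1$-cells $h,k$ and a $2$-cell $F:f\star_0 h\Rightarrow g\star_0 k$ in $\mathcal{A}(X)[Y]$.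 $X$ is $Y$-confluent (resp. locally $Y$-confluent) if every branching (resp. local branching) of $X$ is $Y$-confluent. *)

(* Defs.v *)
From HB Require Import structures.
From mathcomp Require Import all_boot all_algebra.
From mathcomp Require Import finmap.
From mathcomp Require Import boolp.
From mathcomp Require Import monalg.

Set Implicit Arguments.
Unset Strict Implicit.
Unset Printing Implicit Defensive.

Import GRing.Theory.
Local Open Scope ring_scope.
Local Open Scope quotient_scope.

(* The linear extension of f; locked, as unification of unfolded sums over
   concrete monoid algebras diverges easily. *)
HB.lock Definition linext (K : fieldType) (P : choiceType) (V : lmodType K)
    (f : P -> V) (g : {malg K[P]}) : V :=
  \sum_(k <- msupp g) g@_k *: f k.

Section LinearExtension.
Variables (K : fieldType) (P : choiceType).
Implicit Types (g : {malg K[P]}).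

Lemma linextEw (V : lmodType K) (f : P -> V) g (d : {fset P}) :
  (msupp g `<=` d)%fset -> linext f g = \sum_(k <- d) g@_k *: f k.
Proof.
move=> le_gd; rewrite !linext.unlock (big_fset_incl _ le_gd) // => k _ kg.
by rewrite mcoeff_outdom // scale0r.
Qed.

Lemma linext_is_linear (V : lmodType K) (f : P -> V) : linear (linext f).
Proof.
move=> c g1 g2; pose d := (msupp g1 `|` msupp g2)%fset.
have h1 : (msupp g1 `<=` d)%fset by rewrite fsubsetUl.
have h2 : (msupp g2 `<=` d)%fset by rewrite fsubsetUr.
have h3 : (msupp (c *: g1 + g2) `<=` d)%fset.
  apply: (fsubset_trans (msuppD_le _ _)).
  by rewrite fsubUset h2 (fsubset_trans (msuppZ_le _ _) h1).
rewrite (linextEw _ h1) (linextEw _ h2) (linextEw _ h3).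
rewrite scaler_sumr -big_split /=; apply: eq_bigr => k _.
by rewrite mcoeffD mcoeffZ scalerDl scalerA.
Qed.

HB.instance Definition _ (V : lmodType K) (f : P -> V) :=
  GRing.isLinear.Build K {malg K[P]} V *:%R (linext f) (linext_is_linear f).

Lemma linextU (V : lmodType K) (f : P -> V) k : linext f << k >> = f k.
Proof.
by rewrite !linext.unlock msuppU oner_eq0 big_seq_fset1 mcoeffUU scale1r.
Qed.

Lemma malg_lin_ind (Q : {malg K[P]} -> Prop) :
  (forall c a b, Q a -> Q b -> Q (c *: a + b)) -> Q 0 ->
  (forall k, Q << k >>) -> forall g, Q g.
Proof.
move=> QD Q0 QU g; rewrite [g]monalgE; elim/big_ind: _ => //.
  by move=> a b Qa Qb; rewrite -[a]scale1r; apply: QD.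
move=> k _; have -> : << g@_k *g k >> = g@_k *: << k >> :> {malg K[P]}.
  by apply/malgP => j; rewrite mcoeffZ !mcoeffU mulrnAr mulr1.
by rewrite -[X in Q X]addr0; apply: QD.
Qed.

Lemma linext_mono (V : lmodType K) (f f' : P -> V) :
  f =1 f' -> linext f =1 linext f'.
Proof. by move=> ff' g; rewrite !linext.unlock; apply: eq_bigr => k _; rewrite ff'. Qed.

Lemma linextD (V : lmodType K) c (f1 f2 : P -> V) g :
  linext (fun k => c *: f1 k + f2 k) g = c *: linext f1 g + linext f2 g.
Proof.
rewrite !linext.unlock scaler_sumr -big_split; apply: eq_bigr => k _ /=.
by rewrite scalerDr !scalerA mulrC.
Qed.

End LinearExtension.

(* The library gives {malg _} a left-algebra structure only; the alias carries
   in addition the fact that scalars are central. *)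
Definition freealg (K : fieldType) (I : choiceType) := {malg K[{fmonom I}]}.

HB.instance Definition _ (K : fieldType) (I : choiceType) :=
  GRing.Lalgebra.on (freealg K I).

Lemma freealg_mulrC (K : fieldType) (I : choiceType) (k : K)
  (x : freealg K I) : x * (k%:MP : freealg K I) = k *: x.
Proof.
rewrite malgM_def fgmulgU [in RHS](monalgE x) scaler_sumr.
apply: eq_bigr => u _; apply/malgP => v.
by rewrite mcoeffZ !mcoeffU mulm1 mulrnAr mulrC.
Qed.

Lemma freealg_scaleAr (K : fieldType) (I : choiceType) (k : K)
  (x y : freealg K I) : k *: (x * y) = x * (k *: y).
Proof.
transitivity (x * (k%:MP : freealg K I) * y).
  by rewrite freealg_mulrC; apply: scalerAl.
transitivity (x * ((k%:MP : freealg K I) * y)); first exact/esym/mulrA.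
by congr (x * _); apply: mul_malgC.
Qed.

HB.instance Definition _ (K : fieldType) (I : choiceType) :=
  GRing.Lalgebra_isAlgebra.Build K (freealg K I) (@freealg_scaleAr K I).

Lemma freealgUM (K : fieldType) (I : choiceType) (u v : {fmonom I}) :
  << mmul u v >> = << u >> * << v >> :> freealg K I.
Proof. by rewrite malgM_def fgmulUU mulr1. Qed.

Lemma freealg_ind (K : fieldType) (I : choiceType) (Q : freealg K I -> Prop) :
  (forall c a b, Q a -> Q b -> Q (c *: a + b)) -> Q 0 ->
  (forall u, Q << u >>) -> forall a, Q a.
Proof. exact: malg_lin_ind. Qed.

(* Bimodules over a K-algebra are K-symmetric: the two actions of a scalar
   both agree with the K-linear structure. *)
HB.mixin Record Lmodule_isBimodule (K : fieldType) (A : algType K) V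
  of GRing.Lmodule K V := {
  lact : A -> V -> V;
  ract : V -> A -> V;
  lactA : forall a b v, lact a (lact b v) = lact (a * b) v;
  lactDr : forall a, {morph lact a : v w / v + w};
  lactDl : forall v, {morph lact^~ v : a b / a + b};
  lact_scalar : forall k v, lact k%:A v = k *: v;
  ractA : forall v a b, ract (ract v a) b = ract v (a * b);
  ractDl : forall a, {morph ract^~ a : v w / v + w};
  ractDr : forall v, {morph ract v : a b / a + b};
  ract_scalar : forall v k, ract v k%:A = k *: v;
  lractA : forall a v b, ract (lact a v) b = lact a (ract v b)
}.

#[short(type="bimodType")]
HB.structure Definition Bimodule (K : fieldType) (A : algType K) :=
  {V of GRing.Lmodule K V & Lmodule_isBimodule K A V}.

Notation "a *> v" := (lact a v) (at level 40, left associativity) : ring_scope.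
Notation "v <* a" := (ract v a) (at level 40, left associativity) : ring_scope.

Section BimoduleTheory.
Variables (K : fieldType) (A : algType K) (V : bimodType A).
Implicit Types (a b : A) (v w : V) (k : K).

Lemma lact1 v : 1 *> v = v.
Proof. by rewrite -[1]scale1r lact_scalar scale1r. Qed.
Lemma ract1 v : v <* (1 : A) = v.
Proof. by rewrite -[1]scale1r ract_scalar scale1r. Qed.
Lemma lact0 a : a *> (0 : V) = 0.
Proof. by apply: (addIr (a *> 0)); rewrite -lactDr !add0r. Qed.
Lemma ract0 a : (0 : V) <* a = 0.
Proof. by apply: (addIr (0 <* a)); rewrite -ractDl !add0r. Qed.
Lemma lactZl k a v : (k *: a) *> v = k *: (a *> v).
Proof. by rewrite -[k *: a]mulr_algl -lactA lact_scalar. Qed.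
Lemma lactZr k a v : a *> (k *: v) = k *: (a *> v).
Proof. by rewrite -!lact_scalar !lactA mulr_algl mulr_algr. Qed.
Lemma ractZr k a v : v <* (k *: a) = k *: (v <* a).
Proof. by rewrite -[k *: a]mulr_algr -ractA ract_scalar. Qed.
Lemma ractZl k a v : (k *: v) <* a = k *: (v <* a).
Proof. by rewrite -!ract_scalar !ractA mulr_algl mulr_algr. Qed.
Lemma lactN a v : a *> (- v) = - (a *> v).
Proof. by rewrite -!scaleN1r lactZr. Qed.
Lemma ractN a v : (- v) <* a = - (v <* a).
Proof. by rewrite -!scaleN1r ractZl. Qed.

End BimoduleTheory.

Section Regular.
Variables (K : fieldType) (I : choiceType).
Local Notation A := (freealg K I).

Fact regular_scalarl (k : K) (a : A) : k%:A * a = k *: a.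
Proof. exact: mulr_algl. Qed.
Fact regular_scalarr (a : A) (k : K) : a * k%:A = k *: a.
Proof. exact: mulr_algr. Qed.

HB.instance Definition _ := Lmodule_isBimodule.Build K A A
  (@mulrA A) (@mulrDr A) (fun v a b => mulrDl a b v) regular_scalarl
  (fun v a b => esym (mulrA v a b)) (fun a v w => mulrDl v w a) (@mulrDr A)
  regular_scalarr (fun a v b => esym (mulrA a v b)).
End Regular.

(* The bimodule A (x) KZ (x) A, for A the free algebra on I, presented by its
   basis of triples (u, z, v), which stand for u (x) z (x) v = u z v. *)
Definition freebimod (K : fieldType) (I Z : choiceType) :=
  {malg K[({fmonom I} * Z * {fmonom I})%type]}.

HB.instance Definition _ (K : fieldType) (I Z : choiceType) :=
  GRing.Lmodule.on (freebimod K I Z).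

Section FreeBimodule.
Variables (K : fieldType) (I Z : choiceType).
Local Notation A := (freealg K I).
Local Notation T := (freebimod K I Z).
Implicit Types (a b : A) (t : T) (u v : {fmonom I}).

Definition fb_lmul1 u (t : T) : T :=
  linext (fun p => << (mmul u p.1.1, p.1.2, p.2) >>) t.
Definition fb_rmul1 v (t : T) : T :=
  linext (fun p => << (p.1.1, p.1.2, mmul p.2 v) >>) t.
Definition fb_lact a t : T := linext (fb_lmul1^~ t) a.
Definition fb_ract t a : T := linext (fb_rmul1^~ t) a.

Lemma fb_ind (Q : T -> Prop) :
  (forall c t t', Q t -> Q t' -> Q (c *: t + t')) -> Q 0 ->
  (forall u z v, Q << (u, z, v) >>) -> forall t, Q t.
Proof. by move=> QD Q0 QU; apply: malg_lin_ind => // -[[u z] v]; apply: QU. Qed.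

Fact fb_lact_linl t c a b :
  fb_lact (c *: a + b) t = c *: fb_lact a t + fb_lact b t.
Proof. exact: linearP. Qed.
Fact fb_ract_linr t c a b :
  fb_ract t (c *: a + b) = c *: fb_ract t a + fb_ract t b.
Proof. exact: linearP. Qed.
Fact fb_lact_linr a c t t' :
  fb_lact a (c *: t + t') = c *: fb_lact a t + fb_lact a t'.
Proof.
transitivity (linext (fun u => c *: fb_lmul1 u t + fb_lmul1 u t') a).
  by apply: linext_mono => u; apply: linearP.
exact: linextD.
Qed.
Fact fb_ract_linl a c t t' :
  fb_ract (c *: t + t') a = c *: fb_ract t a + fb_ract t' a.
Proof.
transitivity (linext (fun u => c *: fb_rmul1 u t + fb_rmul1 u t') a).
  by apply: linext_mono => u; apply: linearP.
exact: linextD.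
Qed.
Fact fb_lactU u z v w :
  fb_lact << w >> << (u, z, v) >> = << (mmul w u, z, v) >>.
Proof. by rewrite /fb_lact !linextU /fb_lmul1 linextU. Qed.
Fact fb_ractU u z v w :
  fb_ract << (u, z, v) >> << w >> = << (u, z, mmul v w) >>.
Proof. by rewrite /fb_ract !linextU /fb_rmul1 linextU. Qed.
Fact fb_lact0l t : fb_lact 0 t = 0. Proof. exact: linear0. Qed.
Fact fb_ract0r t : fb_ract t 0 = 0. Proof. exact: linear0. Qed.
Fact fb_lact0r a : fb_lact a 0 = 0.
Proof. by have := fb_lact_linr a (-1) 0 0; rewrite !scaleN1r !addNr. Qed.
Fact fb_ract0l a : fb_ract 0 a = 0.
Proof. by have := fb_ract_linl a (-1) 0 0; rewrite !scaleN1r !addNr. Qed.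

Fact fb_lactA a b t : fb_lact a (fb_lact b t) = fb_lact (a * b) t.
Proof.
elim/fb_ind: t => [c t t' Ht Ht'||u z v].
- by rewrite !fb_lact_linr Ht Ht'.
- by rewrite !fb_lact0r.
elim/freealg_ind: b => [c b b' Hb Hb'||w].
- rewrite fb_lact_linl fb_lact_linr Hb Hb'.
  have -> : a * (c *: b + b' : A) = c *: (a * b) + a * b'.
    by rewrite mulrDr scalerAr.
  by rewrite fb_lact_linl.
- by rewrite mulr0 !fb_lact0l fb_lact0r.
elim/freealg_ind: a => [c a a' Ha Ha'||w'].
- have -> : (c *: a + a' : A) * (<< w >> : A) = c *: (a * (<< w >> : A)) + a' * (<< w >> : A).
    by rewrite mulrDl scalerAl.
  by rewrite !fb_lact_linl Ha Ha'.
- by rewrite mul0r !fb_lact0l.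
by rewrite -(freealgUM K w' w) (fb_lactU u z v w) (fb_lactU (mmul w u)) fb_lactU mulmA.
Qed.

Fact fb_ractA t a b : fb_ract (fb_ract t a) b = fb_ract t (a * b).
Proof.
elim/fb_ind: t => [c t t' Ht Ht'||u z v].
- by rewrite !fb_ract_linl Ht Ht'.
- by rewrite !fb_ract0l.
elim/freealg_ind: b => [c b b' Hb Hb'||w].
- have -> : a * (c *: b + b' : A) = c *: (a * b) + a * b'.
    by rewrite mulrDr scalerAr.
  by rewrite !fb_ract_linr Hb Hb'.
- by rewrite mulr0 !fb_ract0r.
elim/freealg_ind: a => [c a a' Ha Ha'||w'].
- have -> : (c *: a + a' : A) * (<< w >> : A) = c *: (a * (<< w >> : A)) + a' * (<< w >> : A).
    by rewrite mulrDl scalerAl.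
  by rewrite !fb_ract_linr !fb_ract_linl Ha Ha'.
- by rewrite mul0r !fb_ract0r fb_ract0l.
transitivity (<< (u, z, mmul v (mmul w' w)) >> : T).
  transitivity (fb_ract << (u, z, mmul v w') >> << w >>).
    by congr (fb_ract _ _); apply: fb_ractU.
  by rewrite mulmA; apply: fb_ractU.
transitivity (fb_ract << (u, z, v) >> << mmul w' w >>).
  by apply/esym; apply: fb_ractU.
by congr (fb_ract _ _); apply: freealgUM.
Qed.

Fact fb_lractA a t b : fb_ract (fb_lact a t) b = fb_lact a (fb_ract t b).
Proof.
elim/fb_ind: t => [c t t' Ht Ht'||u z v].
- by rewrite !fb_lact_linr !fb_ract_linl fb_lact_linr Ht Ht'.
- by rewrite !(fb_lact0r, fb_ract0l).
elim/freealg_ind: b => [c b b' Hb Hb'||w].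
- by rewrite !fb_ract_linr fb_lact_linr Hb Hb'.
- by rewrite !(fb_ract0r, fb_lact0r).
elim/freealg_ind: a => [c a a' Ha Ha'||w'].
- by rewrite !fb_lact_linl fb_ract_linl Ha Ha'.
- by rewrite !fb_lact0l fb_ract0l.
transitivity (<< (mmul w' u, z, mmul v w) >> : T).
  transitivity (fb_ract << (mmul w' u, z, v) >> << w >>).
    by congr (fb_ract _ _); apply: fb_lactU.
  exact: fb_ractU.
transitivity (fb_lact << w' >> << (u, z, mmul v w) >>).
  by apply/esym; apply: fb_lactU.
by congr (fb_lact _ _); apply/esym; apply: fb_ractU.
Qed.

Fact fb_lact_scalar k t : fb_lact k%:A t = k *: t.
Proof.
have E s : fb_lact 1 s = s.
  elim/fb_ind: s => [c s s' H H'||u z v].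
  - by rewrite fb_lact_linr H H'.
  - by rewrite fb_lact0r.
  by rewrite (fb_lactU _ _ _ mone) mul1m.
by rewrite -[k%:A]addr0 fb_lact_linl fb_lact0l addr0 E.
Qed.

Fact fb_ract_scalar t k : fb_ract t k%:A = k *: t.
Proof.
have E s : fb_ract s 1 = s.
  elim/fb_ind: s => [c s s' H H'||u z v].
  - by rewrite fb_ract_linl H H'.
  - by rewrite fb_ract0l.
  by rewrite (fb_ractU _ _ _ mone) mulm1.
by rewrite -[k%:A]addr0 fb_ract_linr fb_ract0r addr0 E.
Qed.

Fact fb_lactDr a : {morph fb_lact a : v w / v + w}.
Proof. by move=> v w; have := fb_lact_linr a 1 v w; rewrite !scale1r. Qed.
Fact fb_ractDl a : {morph fb_ract^~ a : v w / v + w}.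
Proof. by move=> v w; have := fb_ract_linl a 1 v w; rewrite !scale1r. Qed.
Fact fb_lactDl t : {morph fb_lact^~ t : a b / a + b}.
Proof. by move=> a b; have := fb_lact_linl t 1 a b; rewrite !scale1r. Qed.
Fact fb_ractDr t : {morph fb_ract t : a b / a + b}.
Proof. by move=> a b; have := fb_ract_linr t 1 a b; rewrite !scale1r. Qed.

HB.instance Definition _ := Lmodule_isBimodule.Build K A T
  fb_lactA fb_lactDr fb_lactDl fb_lact_scalar
  fb_ractA fb_ractDl fb_ractDr fb_ract_scalar fb_lractA.

End FreeBimodule.

Section ProdBimodule.
Variables (K : fieldType) (A : algType K) (V W : bimodType A).
Implicit Types (a b : A) (x y : (V * W)%type).

Definition prod_lact a x : V * W := (a *> x.1, a *> x.2).
Definition prod_ract x a : V * W := (x.1 <* a, x.2 <* a).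

Fact prod_lactA a b x : prod_lact a (prod_lact b x) = prod_lact (a * b) x.
Proof. by rewrite /prod_lact !lactA. Qed.
Fact prod_lactDr a : {morph prod_lact a : x y / x + y}.
Proof. by move=> x y; rewrite /prod_lact !lactDr. Qed.
Fact prod_lactDl x : {morph prod_lact^~ x : a b / a + b}.
Proof. by move=> a b; rewrite /prod_lact !lactDl. Qed.
Fact prod_lact_scalar k x : prod_lact k%:A x = k *: x.
Proof. by rewrite /prod_lact !lact_scalar. Qed.
Fact prod_ractA x a b : prod_ract (prod_ract x a) b = prod_ract x (a * b).
Proof. by rewrite /prod_ract !ractA. Qed.
Fact prod_ractDl a : {morph prod_ract^~ a : x y / x + y}.
Proof. by move=> x y; rewrite /prod_ract !ractDl. Qed.
Fact prod_ractDr x : {morph prod_ract x : a b / a + b}.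
Proof. by move=> a b; rewrite /prod_ract !ractDr. Qed.
Fact prod_ract_scalar x k : prod_ract x k%:A = k *: x.
Proof. by rewrite /prod_ract !ract_scalar. Qed.
Fact prod_lractA a x b : prod_ract (prod_lact a x) b = prod_lact a (prod_ract x b).
Proof. by rewrite /prod_lact /prod_ract !lractA. Qed.

HB.instance Definition _ := Lmodule_isBimodule.Build K A (V * W)%type
  prod_lactA prod_lactDr prod_lactDl prod_lact_scalar
  prod_ractA prod_ractDl prod_ractDr prod_ract_scalar prod_lractA.

End ProdBimodule.

Definition is_subbimod (K : fieldType) (A : algType K) (V : bimodType A)
    (S : V -> Prop) : Prop :=
  [/\ S 0, forall v w, S v -> S w -> S (v + w),
      forall a v, S v -> S (a *> v) & forall a v, S v -> S (v <* a)].

(* Membership in the smallest sub-bimodule containing P, made boolean so that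
   the library's quotient of Z-modules applies. *)
Definition subbimod_gen (K : fieldType) (A : algType K) (V : bimodType A)
    (P : V -> Prop) (v : V) : bool :=
  `[< forall S, is_subbimod S -> (forall w, P w -> S w) -> S v >].

Section BimoduleQuotient.
Variables (K : fieldType) (A : algType K) (V : bimodType A) (P : V -> Prop).
Local Notation G := (subbimod_gen P).

Lemma subbimod_genP v : P v -> v \in G.
Proof. by move=> Pv; apply/asboolP => S _; apply. Qed.
Lemma subbimod_gen_is_subbimod : is_subbimod (fun v => v \in G).
Proof.
split=> [|v w|a v|a v].
- by apply/asboolP => S [].
- move=> /asboolP Gv /asboolP Gw; apply/asboolP => S subS PS.
  by case: (subS) => _ + _ _; apply; [exact: Gv | exact: Gw].
- move=> /asboolP Gv; apply/asboolP => S subS PS.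
  by case: (subS) => _ _ + _; apply; exact: Gv.
- move=> /asboolP Gv; apply/asboolP => S subS PS.
  by case: (subS) => _ _ _; apply; exact: Gv.
Qed.
Lemma subbimod_gen_min S : is_subbimod S -> (forall w, P w -> S w) ->
  forall v, v \in G -> S v.
Proof. by move=> subS PS v /asboolP; apply. Qed.

Fact subbimod_gen_zmod : zmod_closed G.
Proof.
have [G0 GD GL _] := subbimod_gen_is_subbimod.
split=> // v w Gv Gw; apply: GD => //.
by rewrite -scaleN1r -lact_scalar; apply: GL.
Qed.
HB.instance Definition _ := GRing.isZmodClosed.Build V G subbimod_gen_zmod.

Definition bimod_quot := Quotient.quot (GRing.ZmodClosed.clone V G _).
HB.instance Definition _ := Choice.on bimod_quot.
HB.instance Definition _ := GRing.Zmodule.on bimod_quot.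
HB.instance Definition _ := EqQuotient.on bimod_quot.
HB.instance Definition _ := ZmodQuotient.on bimod_quot.
Local Notation Q := bimod_quot.
Local Notation pi := (\pi_Q : V -> Q).

Lemma bq_eq v w : v - w \in G -> pi v = pi w.
Proof. by move=> h; apply/eqP; rewrite -Quotient.idealrBE. Qed.
Lemma bq_eqP v w : pi v = pi w -> v - w \in G.
Proof. by move=> h; rewrite Quotient.idealrBE; apply/eqP. Qed.
Lemma bq_reprP v : repr (pi v) - v \in G.
Proof. by apply: bq_eqP; rewrite reprK. Qed.

Definition bq_scale (k : K) (q : Q) : Q := pi (k *: repr q).
Definition bq_lact (a : A) (q : Q) : Q := pi (a *> repr q).
Definition bq_ract (q : Q) (a : A) : Q := pi (repr q <* a).

Lemma bq_lact_pi a v : bq_lact a (pi v) = pi (a *> v).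
Proof.
apply: bq_eq; rewrite -lactN -lactDr.
by have [_ _ GL _] := subbimod_gen_is_subbimod; apply/GL/bq_reprP.
Qed.
Lemma bq_ract_pi a v : bq_ract (pi v) a = pi (v <* a).
Proof.
apply: bq_eq; rewrite -ractN -ractDl.
by have [_ _ _ GR] := subbimod_gen_is_subbimod; apply/GR/bq_reprP.
Qed.
Lemma bq_scale_pi k v : bq_scale k (pi v) = pi (k *: v).
Proof. by rewrite /bq_scale -!lact_scalar; exact: bq_lact_pi. Qed.
Lemma bq_piD v w : pi (v + w) = pi v + pi w.
Proof. exact: raddfD. Qed.

Fact bq_scaleA a b q : bq_scale a (bq_scale b q) = bq_scale (a * b) q.
Proof. by rewrite -[q]reprK (bq_scale_pi b) (bq_scale_pi a) bq_scale_pi scalerA. Qed.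
Fact bq_scale1 : left_id 1 bq_scale.
Proof. by move=> q; rewrite -[q]reprK !bq_scale_pi scale1r. Qed.
Fact bq_scaleDr : right_distributive bq_scale +%R.
Proof.
move=> k q r; rewrite -[q]reprK -[r]reprK.
by rewrite -bq_piD !bq_scale_pi scalerDr bq_piD.
Qed.
Fact bq_scaleDl q : {morph bq_scale^~ q : a b / a + b}.
Proof.
by move=> a b; rewrite -[q]reprK !bq_scale_pi scalerDl bq_piD.
Qed.

HB.instance Definition _ := GRing.Zmodule_isLmodule.Build K Q
  bq_scaleA bq_scale1 bq_scaleDr bq_scaleDl.

Fact bq_lactA a b q : bq_lact a (bq_lact b q) = bq_lact (a * b) q.
Proof. by rewrite -[q]reprK (bq_lact_pi b) (bq_lact_pi a) bq_lact_pi lactA. Qed.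
Fact bq_lactDr a : {morph bq_lact a : q r / q + r}.
Proof.
move=> q r; rewrite -[q]reprK -[r]reprK.
by rewrite -bq_piD !bq_lact_pi lactDr bq_piD.
Qed.
Fact bq_lactDl q : {morph bq_lact^~ q : a b / a + b}.
Proof. by move=> a b; rewrite -[q]reprK !bq_lact_pi lactDl bq_piD. Qed.
Fact bq_lact_scalar k q : bq_lact k%:A q = k *: q.
Proof. by rewrite /bq_lact lact_scalar. Qed.
Fact bq_ractA q a b : bq_ract (bq_ract q a) b = bq_ract q (a * b).
Proof. by rewrite -[q]reprK (bq_ract_pi a) (bq_ract_pi b) bq_ract_pi ractA. Qed.
Fact bq_ractDl a : {morph bq_ract^~ a : q r / q + r}.
Proof.
move=> q r; rewrite -[q]reprK -[r]reprK.
by rewrite -bq_piD !bq_ract_pi ractDl bq_piD.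
Qed.
Fact bq_ractDr q : {morph bq_ract q : a b / a + b}.
Proof. by move=> a b; rewrite -[q]reprK !bq_ract_pi ractDr bq_piD. Qed.
Fact bq_ract_scalar q k : bq_ract q k%:A = k *: q.
Proof. by rewrite /bq_ract ract_scalar. Qed.
Fact bq_lractA a q b : bq_ract (bq_lact a q) b = bq_lact a (bq_ract q b).
Proof.
by rewrite -[q]reprK (bq_lact_pi a) (bq_ract_pi b) (bq_ract_pi b) bq_lact_pi lractA.
Qed.

HB.instance Definition _ := Lmodule_isBimodule.Build K A Q
  bq_lactA bq_lactDr bq_lactDl bq_lact_scalar
  bq_ractA bq_ractDl bq_ractDr bq_ract_scalar bq_lractA.

Lemma bq_piL a v : pi (a *> v) = a *> pi v.
Proof. by rewrite -bq_lact_pi. Qed.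
Lemma bq_piR a v : pi (v <* a) = pi v <* a.
Proof. by rewrite -bq_ract_pi. Qed.
Lemma bq_piZ k v : pi (k *: v) = k *: pi v.
Proof. by rewrite -bq_scale_pi. Qed.

End BimoduleQuotient.

Section FreeCells.
Variables (K : fieldType) (I Z : choiceType).
Local Notation A := (freealg K I).
Local Notation T := (freebimod K I Z).

Definition bimodext (V : bimodType A) (f : Z -> V) (x : T) : V :=
  linext (fun p : {fmonom I} * Z * {fmonom I} =>
    (<< p.1.1 >> : A) *> f p.1.2 <* (<< p.2 >> : A)) x.

Lemma bimodextU (V : bimodType A) (f : Z -> V) u z v :
  bimodext f << (u, z, v) >> = (<< u >> : A) *> f z <* (<< v >> : A).
Proof. exact: linextU. Qed.
Lemma bimodextP (V : bimodType A) (f : Z -> V) c x y :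
  bimodext f (c *: x + y) = c *: bimodext f x + bimodext f y.
Proof. exact: linearP. Qed.
Lemma bimodext0 (V : bimodType A) (f : Z -> V) : bimodext f 0 = 0.
Proof. exact: linear0. Qed.
Lemma bimodextD (V : bimodType A) (f : Z -> V) x y :
  bimodext f (x + y) = bimodext f x + bimodext f y.
Proof. by have := bimodextP f 1 x y; rewrite !scale1r. Qed.
Lemma bimodextN (V : bimodType A) (f : Z -> V) x :
  bimodext f (- x) = - bimodext f x.
Proof.
by have := bimodextP f (-1) x 0; rewrite bimodext0 !addr0 !scaleN1r.
Qed.
Lemma bimodextL (V : bimodType A) (f : Z -> V) a x :
  bimodext f (a *> x) = a *> bimodext f x.
Proof.
elim/fb_ind: x => [c x y Hx Hy||u z v].
- by rewrite lactDr lactZr !bimodextP lactDr lactZr Hx Hy.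
- by rewrite lact0 !bimodext0 lact0.
elim/freealg_ind: a => [c a b Ha Hb||w].
- by rewrite !lactDl !lactZl bimodextP Ha Hb.
- have l0 (W : bimodType A) (w : W) : (0 : A) *> w = 0.
    by apply: (addIr ((0 : A) *> w)); rewrite -lactDl !add0r.
  by rewrite !l0 bimodext0.
transitivity (bimodext f << (mmul w u, z, v) >>).
  by congr bimodext; apply: fb_lactU.
apply: (etrans (bimodextU f (mmul w u) z v)).
rewrite [RHS](congr1 _ (bimodextU f u z v)) -lractA lactA.
by congr (_ *> _ <* _); apply: freealgUM.
Qed.
Lemma bimodextR (V : bimodType A) (f : Z -> V) a x :
  bimodext f (x <* a) = bimodext f x <* a.
Proof.
elim/fb_ind: x => [c x y Hx Hy||u z v].
- by rewrite ractDl ractZl !bimodextP ractDl ractZl Hx Hy.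
- by rewrite ract0 !bimodext0 ract0.
elim/freealg_ind: a => [c a b Ha Hb||w].
- by rewrite !ractDr !ractZr bimodextP Ha Hb.
- have r0 (W : bimodType A) (w : W) : w <* (0 : A) = 0.
    by apply: (addIr (w <* (0 : A))); rewrite -ractDr !add0r.
  by rewrite !r0 bimodext0.
transitivity (bimodext f << (u, z, mmul v w) >>).
  by congr bimodext; apply: fb_ractU.
apply: (etrans (bimodextU f u z (mmul v w))).
rewrite [RHS](congr1 (fun y => y <* _) (bimodextU f u z v)) ractA.
by congr (_ <* _); apply: freealgUM.
Qed.

(* One dimension step in the construction of free algebras: V is the bimodule
   of cells of the previous dimension, idc c is the (iterated) identity cell on
   c in V, and s0 z, t0 z are the 0-dimensional source and target of z. *)
Variables (V : bimodType A) (idc : A -> V) (s0 t0 : Z -> A).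

(* (a s0(b) + t0(a) b - t0(a) s0(b)) - (s0(a) b + a t0(b) - s0(a) t0(b)), the
   products of elements of A being seen in V through idc. *)
Definition exchange_relator (a b : T) : T * V :=
  let s x := bimodext s0 x in
  let t x := bimodext t0 x in
  let inT (x : T) : T * V := (x, 0) in
  let inA (c : A) : T * V := (0, idc c) in
  (inT (a <* s b) + inT (t a *> b) - inA (t a * s b))
  - (inT (s a *> b) + inT (a <* t b) - inA (s a * t b)).

Lemma exchange_relatorE a b :
  exchange_relator a b =
    (a <* bimodext s0 b + bimodext t0 a *> b
       - (bimodext s0 a *> b + a <* bimodext t0 b),
     idc (bimodext s0 a * bimodext t0 b) - idc (bimodext t0 a * bimodext s0 b)).
Proof.
congr pair; first by congr (_ - _); apply: subr0.
have E (x y : V) : 0 + 0 - x - (0 + 0 - y) = y - x.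
  by rewrite !add0r opprK addrC.
exact: E.
Qed.

Definition exchange_relators (w : T * V) : Prop :=
  exists a b : T, w = exchange_relator a b.

Definition free_cells : bimodType A := bimod_quot exchange_relators.

Definition cell_class (w : T * V) : free_cells :=
  \pi_(bimod_quot exchange_relators) w.

Definition cell_repr (f : free_cells) : T * V :=
  repr (f : bimod_quot exchange_relators).

(* The map induced on classes by (u z v, g) |-> u (f z) v + g; it does not
   depend on the representative as soon as it kills the relators, see
   boundary_class. *)
Definition boundary (f : Z -> V) (q : free_cells) : V :=
  bimodext f (cell_repr q).1 + (cell_repr q).2.

Lemma cell_reprK q : cell_class (cell_repr q) = q.
Proof. exact: reprK. Qed.
Lemma cell_classD x y : cell_class (x + y) = cell_class x + cell_class y.
Proof. exact: bq_piD. Qed.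
Lemma cell_classZ k x : cell_class (k *: x) = k *: cell_class x.
Proof. exact: bq_piZ. Qed.
Lemma cell_classL a x : cell_class (a *> x) = a *> cell_class x.
Proof. exact: bq_piL. Qed.
Lemma cell_classR a x : cell_class (x <* a) = cell_class x <* a.
Proof. exact: bq_piR. Qed.
Lemma cell_classN x : cell_class (- x) = - cell_class x.
Proof. by rewrite -scaleN1r cell_classZ scaleN1r. Qed.
Lemma cell_class_relator a b : cell_class (exchange_relator a b) = 0.
Proof.
rewrite -(scale0r (cell_class 0)) -cell_classZ scale0r.
by apply: bq_eq; rewrite subr0; apply: subbimod_genP; exists a, b.
Qed.

Lemma cell_class_exchange a b :
  let s x := bimodext s0 x in
  let t x := bimodext t0 x in
  let gen (x : T) := cell_class (x, 0) in
  let idt (c : A) := cell_class (0, idc c) in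
  gen a <* s b + t a *> gen b - idt (t a * s b)
  = s a *> gen b + gen a <* t b - idt (s a * t b).
Proof.
move=> s t gen idt; apply/eqP; rewrite -subr_eq0; apply/eqP.
rewrite -(cell_class_relator a b).
have gL c x : c *> gen x = gen (c *> x).
  by rewrite -cell_classL; congr cell_class; congr pair; apply: lact0.
have gR c x : gen x <* c = gen (x <* c).
  by rewrite -cell_classR; congr cell_class; congr pair; apply: ract0.
have classB x y : cell_class (x - y) = cell_class x - cell_class y.
  by rewrite cell_classD cell_classN.
have E (x x' y y' : T) (c d : V) :
    gen x + gen y - cell_class (0, c) - (gen x' + gen y' - cell_class (0, d))
    = cell_class ((x, 0) + (y, 0) - (0, c) - ((x', 0) + (y', 0) - (0, d))).
  by rewrite (classB (_ - _)) !(classB (_ + _)) !cell_classD.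
have E' (sa sb ta tb : A) :
    gen a <* sb + ta *> gen b - idt (ta * sb)
      - (sa *> gen b + gen a <* tb - idt (sa * tb))
    = cell_class ((a <* sb, 0) + (ta *> b, 0) - (0, idc (ta * sb))
      - ((sa *> b, 0) + (a <* tb, 0) - (0, idc (sa * tb)))).
  rewrite (gL ta) (gR sb) (gL sa) (gR tb); exact: E.
exact: E'.
Qed.

Lemma boundary_relator (f : Z -> V) a b :
  bimodext f (exchange_relator a b).1 + (exchange_relator a b).2 =
    bimodext f a <* bimodext s0 b + bimodext t0 a *> bimodext f b
    - (bimodext s0 a *> bimodext f b + bimodext f a <* bimodext t0 b)
    + (idc (bimodext s0 a * bimodext t0 b)
       - idc (bimodext t0 a * bimodext s0 b)).
Proof.
rewrite exchange_relatorE; congr (_ + _).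
move: (bimodext s0 a) (bimodext s0 b) (bimodext t0 a) (bimodext t0 b).
move=> sa sb ta tb.
rewrite -[LHS]/(bimodext f (a <* sb + ta *> b - (sa *> b + a <* tb))).
rewrite bimodextD bimodextN.
rewrite (bimodextD f (a <* sb)) (bimodextD f (sa *> b)).
by rewrite (bimodextR f sb) (bimodextR f tb) (bimodextL f ta) (bimodextL f sa).
Qed.

Lemma boundary_class (f : Z -> V) :
  (forall a b,
    bimodext f a <* bimodext s0 b + bimodext t0 a *> bimodext f b
    - (bimodext s0 a *> bimodext f b + bimodext f a <* bimodext t0 b)
    + (idc (bimodext s0 a * bimodext t0 b)
       - idc (bimodext t0 a * bimodext s0 b)) = 0) ->
  forall w, boundary f (cell_class w) = bimodext f w.1 + w.2.
Proof.
move=> f0 w; pose S (x : T * V) := bimodext f x.1 + x.2 = 0.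
have subS : is_subbimod S.
  split=> [|x y|a x|a x]; rewrite /S /=.
  - by rewrite bimodext0 addr0.
  - by move=> Sx Sy; rewrite bimodextD addrACA Sx Sy addr0.
  - by move=> Sx; rewrite bimodextL -lactDr Sx lact0.
  - by move=> Sx; rewrite bimodextR -ractDl Sx ract0.
have SP x : exchange_relators x -> S x.
  case=> a [b ->].
  by apply: etrans (f0 a b); apply: boundary_relator.
have := subbimod_gen_min subS SP (bq_reprP exchange_relators w).
rewrite /S /boundary /= bimodextD bimodextN addrACA -opprD.
by move/subr0_eq.
Qed.

End FreeCells.

Fact boundary_cancel_src (V : zmodType) (x y z : V) :
  x + y - (x + z) + (z - y) = 0.
Proof. by rewrite [x + y]addrC addrKA addrA subrK subrr. Qed.
Fact boundary_cancel_tgt (V : zmodType) (x y z : V) :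
  x + y - (z + y) + (z - x) = 0.
Proof. by rewrite [z + y]addrC addrKA addrA subrK subrr. Qed.

(* Sets are rendered by choiceTypes, as required by monoid algebras. *)
Record polygraph1 (K : fieldType) := Polygraph1 {
  gen0 : choiceType;
  gen1 : choiceType;
  gsrc : gen1 -> freealg K gen0;
  gtgt : gen1 -> freealg K gen0
}.

Section OneCells.
Variables (K : fieldType) (X : polygraph1 K).
Local Notation A := (freealg K (gen0 X)).
Local Notation monom := {fmonom (gen0 X)}.

Definition cell1 : bimodType A :=
  free_cells (V := A) id (@gsrc K X) (@gtgt K X).
Definition src1 : cell1 -> A := boundary (@gsrc K X).
Definition tgt1 : cell1 -> A := boundary (@gtgt K X).
Definition id1 (c : A) : cell1 := cell_class _ _ _ (0, c).
(* Meaningful when tgt1 f = src1 g only. *)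
Definition comp1 (f g : cell1) : cell1 := f - id1 (tgt1 f) + g.

Definition monom1 (u : monom) (alpha : gen1 X) (v : monom) : cell1 :=
  cell_class _ _ _ (<< (u, alpha, v) >>, 0).

Definition left_monomial : Prop :=
  forall alpha : gen1 X, exists2 u : monom,
    gsrc alpha = << u >> & u \notin msupp (gtgt alpha).

Definition rewriting_step (f : cell1) : Prop :=
  exists (u : monom) (alpha : gen1 X) (v : monom) (lambda : K) (a : A),
    [/\ lambda != 0,
        exists2 m : monom, src1 (monom1 u alpha v) = << m >> & m \notin msupp a
      & f = lambda *: monom1 u alpha v + id1 a].

Inductive positive1 : cell1 -> Prop :=
| positive1_id a : positive1 (id1 a)
| positive1_comp f g : rewriting_step f -> positive1 g ->
    tgt1 f = src1 g -> positive1 (comp1 f g).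

Inductive red_gt : monom -> monom -> Prop :=
| red_gt_gen alpha u v :
    gsrc alpha = << u >> -> v \in msupp (gtgt alpha) -> red_gt u v
| red_gt_trans u v w : red_gt u v -> red_gt v w -> red_gt u w
| red_gt_mul u v w w' :
    red_gt u v -> red_gt (mmul (mmul w u) w') (mmul (mmul w v) w').

(* well_founded expects the smaller element on the left. *)
Definition terminating : Prop := well_founded (fun u v => red_gt v u).

Definition branching (f g : cell1) : Prop :=
  [/\ positive1 f, positive1 g & src1 f = src1 g].
Definition local_branching (f g : cell1) : Prop :=
  [/\ rewriting_step f, rewriting_step g & src1 f = src1 g].

Lemma src1_class w : src1 (cell_class _ _ _ w) = bimodext (@gsrc K X) w.1 + w.2.
Proof.
apply: boundary_class => {w} a b.
exact: boundary_cancel_src.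
Qed.

Lemma tgt1_class w : tgt1 (cell_class _ _ _ w) = bimodext (@gtgt K X) w.1 + w.2.
Proof.
apply: boundary_class => {w} a b.
exact: boundary_cancel_tgt.
Qed.

Lemma src1_linear k (f g : cell1) : src1 (k *: f + g) = k *: src1 f + src1 g.
Proof.
rewrite -[f]cell_reprK -[g]cell_reprK -cell_classZ -cell_classD.
move: (cell_repr f) (cell_repr g) => x y.
apply: (etrans (src1_class _)).
rewrite (src1_class x) (src1_class y) bimodextP.
have E (V : lmodType K) (a b c d : V) :
    k *: a + b + (k *: c + d) = k *: (a + c) + (b + d).
  by rewrite scalerDr addrACA.
exact: E.
Qed.

Lemma src1L a (f : cell1) : src1 (a *> f) = a * src1 f.
Proof.
rewrite -[f]cell_reprK -cell_classL; move: (cell_repr f) => x.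
apply: (etrans (src1_class _)).
rewrite (src1_class x) bimodextL; apply: esym; exact: mulrDr.
Qed.

Lemma src1R a (f : cell1) : src1 (f <* a) = src1 f * a.
Proof.
rewrite -[f]cell_reprK -cell_classR; move: (cell_repr f) => x.
apply: (etrans (src1_class _)).
rewrite (src1_class x) bimodextR; apply: esym; exact: mulrDl.
Qed.

Lemma tgt1_linear k (f g : cell1) : tgt1 (k *: f + g) = k *: tgt1 f + tgt1 g.
Proof.
rewrite -[f]cell_reprK -[g]cell_reprK -cell_classZ -cell_classD.
move: (cell_repr f) (cell_repr g) => x y.
apply: (etrans (tgt1_class _)).
rewrite (tgt1_class x) (tgt1_class y) bimodextP.
have E (V : lmodType K) (a b c d : V) :
    k *: a + b + (k *: c + d) = k *: (a + c) + (b + d).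
  by rewrite scalerDr addrACA.
exact: E.
Qed.

Lemma tgt1L a (f : cell1) : tgt1 (a *> f) = a * tgt1 f.
Proof.
rewrite -[f]cell_reprK -cell_classL; move: (cell_repr f) => x.
apply: (etrans (tgt1_class _)).
rewrite (tgt1_class x) bimodextL; apply: esym; exact: mulrDr.
Qed.

Lemma tgt1R a (f : cell1) : tgt1 (f <* a) = tgt1 f * a.
Proof.
rewrite -[f]cell_reprK -cell_classR; move: (cell_repr f) => x.
apply: (etrans (tgt1_class _)).
rewrite (tgt1_class x) bimodextR; apply: esym; exact: mulrDl.
Qed.

Lemma cell1_ext (F : cell1 -> A) (Z : choiceType) (s : Z -> cell1) x :
  (forall k f g, F (k *: f + g) = k *: F f + F g) ->
  (forall a f, F (a *> f) = a * F f) -> (forall a f, F (f <* a) = F f * a) ->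
  F (bimodext s x) = bimodext (V := A) (F \o s) x.
Proof.
move=> FP FL FR.
have F0 : F 0 = 0.
  by have := FL 0 0; rewrite lact0 mul0r.
elim/fb_ind: x => [c x y Hx Hy||u z v].
- by rewrite !bimodextP FP Hx Hy.
- by rewrite !bimodext0.
rewrite !bimodextU FR FL; congr (_ * _).
Qed.

End OneCells.

Fact exchange_cancel1 (V : zmodType) (p q r s u : V) :
  p + q + (r + s) - (u + s) = p + r - u + q.
Proof. by rewrite addrACA opprD (addrACA (p + r)) addrK. Qed.
Fact exchange_cancel2 (V : zmodType) (p q r s u : V) :
  p + q + (r + s) - (u + q) = p + r - u + s.
Proof. by rewrite addrACA opprD (addrACA (p + r)) [q + s]addrC addrK. Qed.

Fact exchange_eq0 (V : zmodType) (x y c d : V) :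
  x - c = y - d -> x - y + (d - c) = 0.
Proof.
move=> e; rewrite [d - c]addrC (addrACA x) e [- y + d]addrC.
by rewrite -(opprB y d) subrr.
Qed.

Section CellExchange.
Variables (K : fieldType) (X : polygraph1 K).
Local Notation A := (freealg K (gen0 X)).

Lemma src1_id1 (c : A) : src1 (id1 c : cell1 X) = c.
Proof.
by apply: (etrans (src1_class _)); rewrite bimodext0; apply: add0r.
Qed.
Lemma tgt1_id1 (c : A) : tgt1 (id1 c : cell1 X) = c.
Proof.
by apply: (etrans (tgt1_class _)); rewrite bimodext0; apply: add0r.
Qed.
Lemma id1D (a b : A) : id1 (a + b) = id1 a + id1 b :> cell1 X.
Proof.
rewrite -cell_classD; congr cell_class; congr pair; exact/esym/addr0.
Qed.
Lemma id1L (a b : A) : a *> id1 b = id1 (a * b) :> cell1 X.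
Proof.
by rewrite -cell_classL; congr cell_class; congr pair; apply: lact0.
Qed.
Lemma id1R (a b : A) : id1 a <* b = id1 (a * b) :> cell1 X.
Proof.
by rewrite -cell_classR; congr cell_class; congr pair; apply: ract0.
Qed.

Let N (f g : cell1 X) := f <* src1 g + tgt1 f *> g - id1 (tgt1 f * src1 g).
Let M (f g : cell1 X) := src1 f *> g + f <* tgt1 g - id1 (src1 f * tgt1 g).

Let src1D (f g : cell1 X) : src1 (f + g) = src1 f + src1 g.
Proof. by have := src1_linear 1 f g; rewrite !scale1r. Qed.
Let tgt1D (f g : cell1 X) : tgt1 (f + g) = tgt1 f + tgt1 g.
Proof. by have := tgt1_linear 1 f g; rewrite !scale1r. Qed.

Let N_id2 f g d : N f (g + id1 d) = N f g + f <* d.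
Proof.
rewrite /N src1D src1_id1; move: (tgt1 f) (src1 g) => tf sg.
rewrite (ractDr f sg) (lactDr tf g) id1L (mulrDr tf sg) id1D.
exact: exchange_cancel1.
Qed.
Let M_id2 f g d : M f (g + id1 d) = M f g + f <* d.
Proof.
rewrite /M tgt1D tgt1_id1; move: (src1 f) (tgt1 g) => sf tg.
rewrite (ractDr f tg) (lactDr sf g) id1L (mulrDr sf tg) id1D.
exact: exchange_cancel2.
Qed.
Let N_id1 f g c : N (f + id1 c) g = N f g + c *> g.
Proof.
rewrite /N tgt1D tgt1_id1; move: (tgt1 f) (src1 g) => tf sg.
rewrite (lactDl g tf) (ractDl sg f) id1R (mulrDl tf c sg) id1D.
exact: exchange_cancel2.
Qed.
Let M_id1 f g c : M (f + id1 c) g = M f g + c *> g.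
Proof.
rewrite /M src1D src1_id1; move: (src1 f) (tgt1 g) => sf tg.
rewrite (lactDl g sf) (ractDl tg f) id1R (mulrDl sf c tg) id1D.
exact: exchange_cancel1.
Qed.

Lemma cell1_exchange (f g : cell1 X) :
  f <* src1 g + tgt1 f *> g - id1 (tgt1 f * src1 g)
  = src1 f *> g + f <* tgt1 g - id1 (src1 f * tgt1 g).
Proof.
rewrite -/(N f g) -/(M f g).
pose gen x : cell1 X := cell_class _ _ _ (x, 0).
have dec (h : cell1 X) : exists x c, h = gen x + id1 c.
  exists (cell_repr h).1, (cell_repr h).2.
  rewrite -[LHS]cell_reprK -cell_classD; case: (cell_repr h) => x c.
  by congr cell_class; congr pair; [apply/esym/addr0 | apply/esym/add0r].
have [x [c ->]] := dec f; have [y [d ->]] := dec g.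
suff NM : N (gen x) (gen y) = M (gen x) (gen y).
  have E1 := N_id2 (gen x + id1 c) (gen y) d.
  have E2 := N_id1 (gen x) (gen y) c.
  have E3 := M_id2 (gen x + id1 c) (gen y) d.
  have E4 := M_id1 (gen x) (gen y) c.
  have E5 := etrans E2 (etrans (congr1 (fun z => z + c *> gen y) NM) (esym E4)).
  exact: etrans E1 (etrans (congr1 (+%R^~ _) E5) (esym E3)).
have sE z : src1 (gen z) = bimodext (@gsrc K X) z.
  by apply: (etrans (src1_class _)); apply: addr0.
have tE z : tgt1 (gen z) = bimodext (@gtgt K X) z.
  by apply: (etrans (tgt1_class _)); apply: addr0.
rewrite /N /M (sE x) (sE y) (tE x) (tE y).
exact: cell_class_exchange.
Qed.

End CellExchange.

Record cellular_extension (K : fieldType) (X : polygraph1 K) :=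
  CellularExtension {
    gen2 : choiceType;
    gsrc2 : gen2 -> cell1 X;
    gtgt2 : gen2 -> cell1 X;
    gsrc2_src : forall y, src1 (gsrc2 y) = src1 (gtgt2 y);
    gsrc2_tgt : forall y, tgt1 (gsrc2 y) = tgt1 (gtgt2 y)
  }.

Section TwoCells.
Variables (K : fieldType) (X : polygraph1 K) (Y : cellular_extension X).
Local Notation A := (freealg K (gen0 X)).

(* Since source and target of a generator are parallel, the 0-dimensional
   source and target may be read off from gsrc2 alone. *)
Definition cell2 : bimodType A :=
  free_cells (V := cell1 X) (@id1 K X)
    (fun y : gen2 Y => src1 (gsrc2 y)) (fun y => tgt1 (gsrc2 y)).
Definition src2 : cell2 -> cell1 X := boundary (@gsrc2 K X Y).
Definition tgt2 : cell2 -> cell1 X := boundary (@gtgt2 K X Y).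

Lemma src2_class w :
  src2 (cell_class _ _ _ w) = bimodext (@gsrc2 K X Y) w.1 + w.2.
Proof.
apply: boundary_class => {w} a b.
have sE z :=
  @cell1_ext K X _ (gen2 Y) (@gsrc2 K X Y) z (@src1_linear K X) (@src1L K X) (@src1R K X).
have tE z :=
  @cell1_ext K X _ (gen2 Y) (@gsrc2 K X Y) z (@tgt1_linear K X) (@tgt1L K X) (@tgt1R K X).
have := cell1_exchange (bimodext (@gsrc2 K X Y) a) (bimodext (@gsrc2 K X Y) b).
by rewrite (sE a) (sE b) (tE a) (tE b); apply: exchange_eq0.
Qed.

Lemma tgt2_class w :
  tgt2 (cell_class _ _ _ w) = bimodext (@gtgt2 K X Y) w.1 + w.2.
Proof.
apply: boundary_class => {w} a b.
have se : @src1 K X \o @gtgt2 K X Y = fun y => src1 (gsrc2 y).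
  by apply/funext => y; rewrite /= gsrc2_src.
have te : @tgt1 K X \o @gtgt2 K X Y = fun y => tgt1 (gsrc2 y).
  by apply/funext => y; rewrite /= gsrc2_tgt.
have sE z :=
  @cell1_ext K X _ (gen2 Y) (@gtgt2 K X Y) z (@src1_linear K X) (@src1L K X) (@src1R K X).
have tE z :=
  @cell1_ext K X _ (gen2 Y) (@gtgt2 K X Y) z (@tgt1_linear K X) (@tgt1L K X) (@tgt1R K X).
have {}sE z := etrans (sE z) (congr1 (fun h => bimodext (V := A) h z) se).
have {}tE z := etrans (tE z) (congr1 (fun h => bimodext (V := A) h z) te).
have := cell1_exchange (bimodext (@gtgt2 K X Y) a) (bimodext (@gtgt2 K X Y) b).
by rewrite (sE a) (sE b) (tE a) (tE b); apply: exchange_eq0.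
Qed.

(* src2 F and tgt2 F are always parallel, so h and k have the same target. *)
Definition Y_confluent_branching (f g : cell1 X) : Prop :=
  exists (h k : cell1 X),
    [/\ positive1 h, positive1 k, tgt1 f = src1 h, tgt1 g = src1 k
      & exists F : cell2, src2 F = comp1 f h /\ tgt2 F = comp1 g k].

Definition Y_confluent : Prop :=
  forall f g : cell1 X, branching f g -> Y_confluent_branching f g.
Definition locally_Y_confluent : Prop :=
  forall f g : cell1 X, local_branching f g -> Y_confluent_branching f g.

End TwoCells.

(* Main.v *)
Require Import Defs.
From mathcomp Require Import all_boot all_algebra.
From mathcomp Require Import finmap boolp monalg.

(** Two observations turn Newman's lemma for 1-cells of a free 1-algebra into
    the usual induction.

    The first is that reduction of 0-cells terminates although only the order
    on monomials is assumed wellfounded. A rewriting step removes one monomial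
    from the support of its source and adds only smaller ones
    ([reduces_descent]). This is a set version of the Dershowitz-Manna multiset
    order, wellfounded as soon as the order on elements is
    ([wf_fset_descent]).

    The second is that the free 2-algebra is a linear object: source and target
    of 2-cells are additive, and every 1-cell has an identity 2-cell. So the
    relation that some 2-cell goes from f to g is closed under sums and contains
    all pairs (f, f). As f * g is f - 1 + g, with an identity 1 on the target
    of f, adding constants to 2-cells yields vertical composition
    ([cell2_rel_trans]) and whiskering by 1-cells ([cell2_rel_compl],
    [cell2_rel_compr]).

    Newman's diagram then closes by induction on the common source. For a
    branching (f1 * f2, g1 * g2) with f1 and g1 rewriting steps, local
    confluence gives f1 * h1 => g1 * k1; the induction hypothesis at the target
    of f1 gives f2 * h2 => h1 * k2, and at the target of g1 it gives
    k1 * k2 * h3 => g2 * k3. Pasting the three 2-cells yields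
    f1 * f2 * h2 * h3 => f1 * h1 * k2 * h3 => g1 * k1 * k2 * h3
    => g1 * g2 * k3. *)

Set Implicit Arguments.
Unset Strict Implicit.
Unset Printing Implicit Defensive.

Import GRing.Theory.
Local Open Scope ring_scope.

(** * A wellfounded order on finite sets *)

Section FsetDescent.
Local Open Scope fset_scope.
Variables (T : choiceType) (lt : T -> T -> Prop).
Implicit Types (A B : {fset T}) (x y : T).

Definition fset_descent B A : Prop :=
  exists x, [/\ x \in A, x \notin B
    & forall y, y \in B -> y \in A \/ lt y x].

(** A descent from B by removal of x is also one from any larger A, because
    the elements of B are in A. *)
Lemma Acc_fset_sub A B : B `<=` A -> Acc fset_descent A -> Acc fset_descent B.
Proof.
move=> /fsubsetP BA [accA]; constructor=> C [x [xB xC ltC]]; apply: accA.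
exists x; split=> // [|y yC]; first exact: BA.
by case: (ltC y yC) => [/BA|]; [left|right].
Qed.

(** The heart of the Dershowitz-Manna argument, for one element x. A descent
    from A with x added either removes x, trading it for finitely many smaller
    elements that the hypothesis allows to be added one at a time, or removes
    an element of A, and then induction on the accessibility of A applies. *)
Lemma Acc_fset1U x A :
  (forall y B, lt y x -> Acc fset_descent B -> Acc fset_descent (y |` B)) ->
  Acc fset_descent A -> Acc fset_descent (x |` A).
Proof.
move=> IHx accA; elim: accA => {}A accA IHA; constructor=> B [y [yxA yB ltB]].
have accA' : Acc fset_descent A by constructor.
have [eyx | neyx] := eqVneq y x.
  (* x is removed: B is included in A with finitely many smaller elements. *)
  have accU (s : seq T) : (forall z, z \in s -> lt z x) ->
      Acc fset_descent (A `|` [fset z in s]).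
    elim: s => [|z s IHs] lts.
      by apply: Acc_fset_sub accA'; apply/fsubsetP => z; rewrite !inE orbF.
    have accs : Acc fset_descent (A `|` [fset z in s]).
      by apply: IHs => z' z's; apply: lts; rewrite inE z's orbT.
    apply: Acc_fset_sub (IHx z _ (lts z (mem_head _ _)) accs).
    by apply/fsubsetP => z'; rewrite !inE orbCA.
  apply: Acc_fset_sub (accU [seq z <- B | z \notin A] _).
    apply/fsubsetP => z zB; rewrite !inE /= mem_filter zB andbT.
    by case: (z \in A).
  move=> z; rewrite mem_filter => /andP[zA zB].
  case: (ltB z zB) => [|]; last by rewrite eyx.
  rewrite in_fset1U (negbTE zA) orbF => /eqP ezx.
  by move: yB; rewrite eyx -ezx zB.
(* y is an element of A: B without x is a descent from A. *)
have yA : y \in A by move: yxA; rewrite in_fset1U (negbTE neyx).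
apply: Acc_fset_sub (IHA (B `\ x) _).
  by apply/fsubsetP => z zB; rewrite !inE zB andbT; case: eqP.
exists y; split=> // [|z]; first by rewrite !inE (negbTE yB) andbF.
rewrite in_fsetD1 => /andP[zx zB].
by case: (ltB z zB) => [|]; [rewrite in_fset1U (negbTE zx); left | right].
Qed.

Lemma wf_fset_descent : well_founded lt -> well_founded fset_descent.
Proof.
move=> wf; have accU x A : Acc fset_descent A -> Acc fset_descent (x |` A).
  elim/(well_founded_ind wf): x A => x IH A.
  by apply: Acc_fset1U => y B yx; apply: IH.
elim/fset1U_rect=> [|x A _ IHA]; last exact: accU.
by constructor=> B [x []]; rewrite in_fset0.
Qed.

End FsetDescent.

(** * Reduction of 0-cells *)

Section Reduction.
Variables (K : fieldType) (X : polygraph1 K).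
Local Notation A := (freealg K (gen0 X)).
Local Notation monom := {fmonom (gen0 X)}.

Lemma src1_monom1 (u v : monom) (alpha : gen1 X) :
  src1 (monom1 u alpha v) = (<< u >> : A) * gsrc alpha * << v >>.
Proof.
by apply: (etrans (src1_class _)); rewrite bimodextU; apply: addr0.
Qed.

Lemma tgt1_monom1 (u v : monom) (alpha : gen1 X) :
  tgt1 (monom1 u alpha v) = (<< u >> : A) * gtgt alpha * << v >>.
Proof.
by apply: (etrans (tgt1_class _)); rewrite bimodextU; apply: addr0.
Qed.

Lemma msupp_monom_mul (u v w : monom) (g : A) :
  w \in msupp ((<< u >> : A) * g * << v >>) ->
  exists2 x, x \in msupp g & w = mmul (mmul u x) v.
Proof.
have msupp1 (z : monom) z' : z' \in msupp (<< z >> : A) -> z' = z.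
  by rewrite msuppU oner_eq0 => /fset1P.
move=> /msuppM_le [y [z [/msuppM_le [y1 [x [/msupp1 -> xg ->]]]]]].
by move=> /msupp1 -> ->; exists x.
Qed.

Lemma monom_inj (u v : monom) : << u >> = << v >> :> A -> u = v.
Proof.
move=> /(congr1 (fun g : A => g@_u)).
rewrite !mcoeffU eqxx; case: eqP => // _ /eqP.
by rewrite oner_eq0.
Qed.

(** All monomials of u t(alpha) v are of the form u x v with x in the support
    of t(alpha), and m is u s(alpha) v, so stability by product applies. *)
Lemma red_gt_monom1 (u v m w : monom) (alpha : gen1 X) :
  left_monomial X -> src1 (monom1 u alpha v) = << m >> ->
  w \in msupp (tgt1 (monom1 u alpha v)) -> red_gt m w.
Proof.
move=> lm; have [s sE _] := lm alpha.
rewrite src1_monom1 sE -!freealgUM => /monom_inj <-.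
rewrite tgt1_monom1 => /msupp_monom_mul [x xt ->].
exact/red_gt_mul/(red_gt_gen sE).
Qed.

(** The smaller 0-cell comes first, as [well_founded] expects. *)
Definition reduces (b a : A) : Prop :=
  exists f : cell1 X, [/\ rewriting_step f, src1 f = a & tgt1 f = b].

Lemma red_gt_irrefl (m : monom) : terminating X -> ~ red_gt m m.
Proof.
move=> term; elim/(well_founded_ind term): m => m IH mm; exact: (IH m mm mm).
Qed.

(** For a step c f + 1_d with source c m + d, the monomial m really lies in
    the support of the source since d does not contain it. It does not come
    back in the target, as it would then be smaller than itself. *)
Lemma reduces_descent (a b : A) :
  left_monomial X -> terminating X -> reduces b a ->
  fset_descent (fun v u : monom => red_gt u v) (msupp b) (msupp a).
Proof.
move=> lm term [_ [[u [alpha [v [c [d [c0 [m sE md] ->]]]]]] <- <-]].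
rewrite src1_linear tgt1_linear src1_id1 tgt1_id1 sE.
have dm : d@_m = 0 by apply/eqP; rewrite mcoeff_eq0.
have lt w : w \in msupp (tgt1 (monom1 u alpha v)) -> red_gt m w.
  exact: red_gt_monom1.
exists m; split.
- by rewrite -mcoeff_neq0 mcoeffD mcoeffZ mcoeffU eqxx mulr1 dm addr0.
- apply/negP => /(fsubsetP (msuppD_le _ _)); rewrite in_fsetU (negbTE md) orbF.
  by move=> /(fsubsetP (msuppZ_le _ _)) /lt; apply: red_gt_irrefl.
move=> w /(fsubsetP (msuppD_le _ _)); rewrite in_fsetU => /orP[|wd].
  by move=> /(fsubsetP (msuppZ_le _ _)) /lt; right.
left; rewrite -mcoeff_neq0 mcoeffD mcoeffZ mcoeffU.
case: (eqVneq m w) => [mw|_]; first by rewrite mw wd in md.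
by rewrite mulr0 add0r mcoeff_neq0.
Qed.

Lemma wf_reduces : left_monomial X -> terminating X -> well_founded reduces.
Proof.
move=> lm term a; have := wf_fset_descent term (msupp a).
move Es: (msupp a) => s acc; elim: acc a Es => {}s _ IH a Es.
constructor=> b /(reduces_descent lm term) ba; apply: (IH (msupp b)) => //.
by rewrite -Es.
Qed.

End Reduction.

(** * Composition of 1-cells *)

Section Composition.
Variables (K : fieldType) (X : polygraph1 K).
Local Notation A := (freealg K (gen0 X)).
Implicit Types (f g h : cell1 X).

Lemma src1D f g : src1 (f + g) = src1 f + src1 g.
Proof. by have := src1_linear 1 f g; rewrite !scale1r. Qed.
Lemma tgt1D f g : tgt1 (f + g) = tgt1 f + tgt1 g.
Proof. by have := tgt1_linear 1 f g; rewrite !scale1r. Qed.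

Lemma src1N f : src1 (- f) = - src1 f.
Proof.
apply: (addIr (src1 f)); rewrite -src1D !addNr.
by apply: (addIr (src1 f)); rewrite -src1D !add0r.
Qed.
Lemma tgt1N f : tgt1 (- f) = - tgt1 f.
Proof.
apply: (addIr (tgt1 f)); rewrite -tgt1D !addNr.
by apply: (addIr (tgt1 f)); rewrite -tgt1D !add0r.
Qed.

Lemma src1_comp f g : tgt1 f = src1 g -> src1 (comp1 f g) = src1 f.
Proof. by move=> fg; rewrite /comp1 !src1D src1N src1_id1 fg subrK. Qed.
Lemma tgt1_comp f g : tgt1 (comp1 f g) = tgt1 g.
Proof. by rewrite /comp1 !tgt1D tgt1N tgt1_id1 subrr add0r. Qed.

Lemma comp1A f g h : comp1 f (comp1 g h) = comp1 (comp1 f g) h.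
Proof. by rewrite {3}/comp1 tgt1_comp /comp1 !addrA. Qed.
Lemma comp1_id f : comp1 f (id1 (tgt1 f)) = f.
Proof. by rewrite /comp1 subrK. Qed.
Lemma comp1_idl f : comp1 (id1 (src1 f)) f = f.
Proof. by rewrite /comp1 tgt1_id1 subrr add0r. Qed.

Lemma positive1_cat f g :
  positive1 f -> positive1 g -> tgt1 f = src1 g -> positive1 (comp1 f g).
Proof.
move=> pf pg; elim: pf => [a|f1 f2 sf1 pf2 IH f12].
  by rewrite tgt1_id1 => ->; rewrite comp1_idl.
rewrite tgt1_comp => f2g; rewrite -comp1A.
by apply: positive1_comp => //; [apply: IH | rewrite src1_comp].
Qed.

End Composition.

(** * Existence of a 2-cell between 1-cells *)

Section TwoCellRelation.
Variables (K : fieldType) (X : polygraph1 K) (Y : cellular_extension X).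
Local Notation A := (freealg K (gen0 X)).
Implicit Types (f g h : cell1 X) (F G : cell2 Y).

Definition cell2_rel f g : Prop :=
  exists F : cell2 Y, src2 F = f /\ tgt2 F = g.

Lemma src2D F G : src2 (F + G) = src2 F + src2 G.
Proof.
rewrite -[F]cell_reprK -[G]cell_reprK -cell_classD.
move: (cell_repr F) (cell_repr G) => x y.
apply: (etrans (src2_class _)); rewrite (src2_class x) (src2_class y).
by rewrite bimodextD addrACA.
Qed.

Lemma tgt2D F G : tgt2 (F + G) = tgt2 F + tgt2 G.
Proof.
rewrite -[F]cell_reprK -[G]cell_reprK -cell_classD.
move: (cell_repr F) (cell_repr G) => x y.
apply: (etrans (tgt2_class _)); rewrite (tgt2_class x) (tgt2_class y).
by rewrite bimodextD addrACA.
Qed.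

Lemma cell2_rel_refl f : cell2_rel f f.
Proof.
exists (cell_class _ _ _ (0, f)); split.
  by apply: (etrans (src2_class _)); rewrite bimodext0 add0r.
by apply: (etrans (tgt2_class _)); rewrite bimodext0 add0r.
Qed.

Lemma cell2_relD f g f' g' :
  cell2_rel f g -> cell2_rel f' g' -> cell2_rel (f + f') (g + g').
Proof.
by move=> [F [<- <-]] [G [<- <-]]; exists (F + G); rewrite src2D tgt2D.
Qed.

(** The vertical composite of F : f => g and G : g => h is F + G - 1_g. *)
Lemma cell2_rel_trans g f h : cell2_rel f g -> cell2_rel g h -> cell2_rel f h.
Proof.
move=> fg gh; have := cell2_relD (cell2_relD fg gh) (cell2_rel_refl (- g)).
by rewrite addrK [g + h]addrC addrK.
Qed.

(** The generating 2-cells are parallel, and taking the 0-dimensional target is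
    compatible with the bimodule structure. *)
Lemma cell2_rel_tgt1 f g : cell2_rel f g -> tgt1 f = tgt1 g.
Proof.
move=> [F [<- <-]]; rewrite -[F]cell_reprK; move: (cell_repr F) => x.
have tE (s : gen2 Y -> cell1 X) : tgt1 (bimodext s x.1 + x.2) =
    bimodext (V := A) (@tgt1 K X \o s) x.1 + tgt1 x.2.
  apply: etrans (tgt1D _ _) _; apply: (congr1 (+%R^~ (tgt1 x.2))).
  exact: (cell1_ext s x.1 (@tgt1_linear K X) (@tgt1L K X) (@tgt1R K X)).
have te : @tgt1 K X \o @gsrc2 K X Y = @tgt1 K X \o @gtgt2 K X Y.
  by apply/funext => y; rewrite /= gsrc2_tgt.
apply: (etrans (congr1 (@tgt1 K X) (src2_class x))); rewrite tE te -tE.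
exact: esym (congr1 (@tgt1 K X) (tgt2_class x)).
Qed.

Lemma cell2_rel_compl f g h :
  cell2_rel g h -> cell2_rel (comp1 f g) (comp1 f h).
Proof. by move=> gh; apply: cell2_relD gh; apply: cell2_rel_refl. Qed.

(** The composites subtract the identities on the targets of f and g, which
    agree because a 2-cell has parallel source and target. *)
Lemma cell2_rel_compr f g h :
  cell2_rel f g -> cell2_rel (comp1 f h) (comp1 g h).
Proof.
move=> fg; rewrite /comp1 (cell2_rel_tgt1 fg) -!addrA.
by apply: cell2_relD fg _; apply: cell2_rel_refl.
Qed.

(** The branching closes with g on the side of the identity and an identity on
    the side of g. *)
Lemma Y_confluent_idl a g :
  positive1 g -> src1 g = a -> Y_confluent_branching Y (id1 a) g.
Proof.
move=> pg <-; exists g, (id1 (tgt1 g)); split; first exact: pg.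
- exact: positive1_id.
- exact: tgt1_id1.
- exact: esym (src1_id1 _).
by rewrite comp1_id comp1_idl; apply: cell2_rel_refl.
Qed.

Lemma Y_confluent_idr f a :
  positive1 f -> src1 f = a -> Y_confluent_branching Y f (id1 a).
Proof.
move=> pf <-; exists (id1 (tgt1 f)), f; split; first exact: positive1_id.
- exact: pf.
- exact: esym (src1_id1 _).
- exact: tgt1_id1.
by rewrite comp1_id comp1_idl; apply: cell2_rel_refl.
Qed.

End TwoCellRelation.

Theorem proposition4p1p3 (K : fieldType) (X : polygraph1 K)
    (Y : cellular_extension X) :
  left_monomial X -> terminating X ->
  locally_Y_confluent Y -> Y_confluent Y.
Proof.
move=> lm term loc f g.
move Ea: (src1 f) => a.
elim/(well_founded_ind (wf_reduces lm term)): a f g Ea => a IH f g Ea.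
move=> [pf pg]; rewrite Ea => /esym; move: Ea.
case: pf => [b|f1 f2 sf1 pf2 f12].
  by rewrite src1_id1 => ->; apply: Y_confluent_idl.
case: pg => [b|g1 g2 sg1 pg2 g12].
  move=> Ef; rewrite src1_id1 => ->.
  by apply: Y_confluent_idr; first exact: positive1_comp.
rewrite (src1_comp f12) (src1_comp g12) => Ef1 Eg1.
have [|h1 [k1 [ph1 pk1 fh1 gk1 F1]]] := loc f1 g1.
  by split; [exact: sf1 | exact: sg1 | rewrite Ef1 Eg1].
have [||h2 [k2 [ph2 pk2 fh2 hk2 F2]]] := IH (tgt1 f1) _ f2 h1 (esym f12).
- by exists f1; split; [exact: sf1 | exact: Ef1 |].
- by split; [exact: pf2 | exact: ph1 | rewrite -f12].
have k12 : tgt1 k1 = src1 k2.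
  by have := cell2_rel_tgt1 F1; rewrite !tgt1_comp => <-.
have sk12 : src1 (comp1 k1 k2) = tgt1 g1 by rewrite src1_comp.
have [||h3 [k3 [ph3 pk3 kh3 gk3 F3]]] := IH (tgt1 g1) _ (comp1 k1 k2) g2 sk12.
- by exists g1; split; [exact: sg1 | exact: Eg1 |].
- by split; [exact: positive1_cat | exact: pg2 | rewrite sk12].
have h23 : tgt1 h2 = src1 h3.
  by have := cell2_rel_tgt1 F2; rewrite -kh3 !tgt1_comp.
exists (comp1 h2 h3), k3; split.
- exact: positive1_cat.
- exact: pk3.
- by rewrite tgt1_comp src1_comp.
- by rewrite tgt1_comp.
(* Paste F2 whiskered by f1 and h3, F1 whiskered by k2 and h3, and F3
   whiskered by g1. *)
apply: (@cell2_rel_trans _ _ _ (comp1 (comp1 f1 (comp1 h1 k2)) h3)).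
  rewrite comp1A -(comp1A f1); apply: cell2_rel_compr.
  exact: cell2_rel_compl.
apply: (@cell2_rel_trans _ _ _ (comp1 g1 (comp1 (comp1 k1 k2) h3))).
  by rewrite !comp1A; do 2![apply: cell2_rel_compr].
by rewrite -(comp1A g1 g2); apply: cell2_rel_compl.
Qed.
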